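(* Let $1\le k\le n$ and let $\alpha_k\le\cdots\le\alpha_n$ be given. Then the stepup procedure with critical values $\alpha_i$, $k\le i\le n$, is equivalent to the closed testing procedure with critical values $\beta_{i,|I|}=\alpha_{n-|I|+i}$, $k\le i\le|I|$, $k\le|I|\le n$.
   Context: Setting: $H_1,\dots,H_n$ are null hypotheses with $p$-values $P_1,\dots,P_n$. The ordered $p$-values are $P_{(1)}\le\cdots\le P_{(n)}$ with associated hypotheses $H_{(1)},\dots,H_{(n)}$; the same ordering is used by all procedures. For $I\subset\{1,\dots,n\}$ with $|I|\ge k$, $H_I=\bigcap_{i\in I}H_i$ and $P_{1:I}\le\cdots\le P_{|I|:I}$ are the ordered values of $P_i$, $i\in I$. Closed testing procedure with critical values $\beta_{i,|I|}$: the local test of $H_I$ rejects $H_I$ iff $P_{j:I}\le\beta_{j,|I|}$ for at least one $j\in\{k,\dots,|I|\}$. The closed testing procedure automatically rejects $H_{(1)},\dots,H_{(k-1)}$, and it rejects any other $H_i$ iff $H_I$ is rejected by its local test for all $I\subset\{1,\dots,n\}$ with $|I|\ge k$, $i\in I$ and $P_i\ge P_{k:I}$. Stepup procedure with critical values $\alpha_k\le\cdots\le\alpha_n$: if $P_{(n)}\le\alpha_n$, reject all null hypotheses; if $P_{(r)}>\alpha_r$ for all $r\ge k$, reject $H_{(1)},\dots,H_{(k-1)}$ only; otherwise reject $H_{(1)},\dots,H_{(r)}$, where $r\ge k$ is the smallest index satisfying $P_{(n)}>\alpha_n,\dots,P_{(r+1)}>\alpha_{r+1}$. Two procedures are equivalent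 if they always reject (and accept) the same individual hypotheses. *)

(* Defs.v *)
From mathcomp Require Import all_boot all_order all_fingroup all_algebra.

Set Implicit Arguments.
Unset Strict Implicit.
Unset Printing Implicit Defensive.

Import Order.TTheory GRing.Theory Num.Theory.
Local Open Scope ring_scope.

Section Procedures.
Variables (R : realFieldType) (n : nat).
Implicit Types (P : 'I_n -> R) (s : 'S_n) (I : {set 'I_n}) (i : 'I_n).

(* Hypotheses are identified with their indices in 'I_n (counted from 0),
   and intersection hypotheses with the index sets I : {set 'I_n}.  Ranks,
   sizes and the indices of critical values are natural numbers counted
   from 1, as in the usual notation. *)

(* P_{j:I}, the j-th smallest of the p-values P i, i in I; meaningful for
   1 <= j <= #|I| only. *)
Definition order_stat P I (j : nat) : R :=
  (sort <=%O [seq P i | i <- enum I])`_j.-1.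

(* P_(j), the j-th smallest of all the p-values. *)
Definition ordered_pval P (j : nat) : R := order_stat P [set: 'I_n] j.

(* The permutation s lists the hypotheses by increasing p-value: H_(j) is the
   hypothesis with index s (j - 1).  It is part of the data because it is not
   determined by P when there are ties. *)
Definition pval_ordering P s : Prop :=
  forall a b : 'I_n, (a <= b)%N -> P (s a) <= P (s b).

(* The indices of H_(1), ..., H_(r). *)
Definition first_hyps s (r : nat) : {set 'I_n} :=
  [set s a | a : 'I_n & (a < r)%N].

(* A multiple testing procedure maps the observed p-values and their ordering
   to the set of (indices of) rejected hypotheses. *)
Definition procedure : Type := ('I_n -> R) -> 'S_n -> {set 'I_n}.

Definition equivalent (proc1 proc2 : procedure) : Prop :=
  forall P s, pval_ordering P s -> proc1 P s = proc2 P s.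

Definition local_test (k : nat) (beta : nat -> nat -> R) P I : bool :=
  [exists j : 'I_n.+1,
    [&& (k <= j)%N, (j <= #|I|)%N & order_stat P I j <= beta j #|I|]].

(* beta i m is the critical value beta_{i,m}, used for k <= i <= m <= n only. *)
Definition closed_testing (k : nat) (beta : nat -> nat -> R) : procedure :=
  fun P s =>
    first_hyps s k.-1 :|:
    [set i | [forall I : {set 'I_n},
       [&& (k <= #|I|)%N, i \in I & order_stat P I k <= P i]
         ==> local_test k beta P I]].

(* The smallest r with k <= r <= n such that P_(j) > alpha_j for all
   r < j <= n; for k <= n the condition always holds at r = n. *)
Definition stepup_index (k : nat) (alpha : nat -> R) P : nat :=
  [arg min_(r < (ord_max : 'I_n.+1) |
     (k <= r)%N &&
     [forall j : 'I_n.+1, (r < j)%N ==> (alpha j < ordered_pval P j)]) r].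

(* alpha i is used for k <= i <= n only. *)
Definition stepup (k : nat) (alpha : nat -> R) : procedure :=
  fun P s =>
    if ordered_pval P n <= alpha n then [set: 'I_n]
    else if [forall r : 'I_n.+1, (k <= r)%N ==> (alpha r < ordered_pval P r)]
    then first_hyps s k.-1
    else first_hyps s (stepup_index k alpha P).

End Procedures.

(* Main.v *)
Require Import Defs.
From mathcomp Require Import all_boot all_order all_fingroup all_algebra.

(** Everything reduces to counting p-values below a threshold: P_{j:I} <= x
    holds exactly when at least j indices of I have a p-value at most x
    ([order_stat_le]), and the set of all indices with p-value at most x is an
    initial segment of the given ordering ([sublevel_initial]), however ties
    are broken.  In all its cases the stepup procedure rejects
    H_(1), ..., H_(r) for some k - 1 <= r <= n such that P_(j) > alpha_j for
    all j > r, and P_(r) <= alpha_r as soon as r >= k ([stepup_first_hyps]).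

    If H_i is among these and k <= r, let I contain i, with m elements and
    P_{k:I} <= P_i.  Let c be the number of indices of I with p-value at most
    alpha_r.  As P_i <= alpha_r, at least k of them exist, so c >= k; as only
    n - m indices lie outside I, r <= n - m + c.  Hence
    P_{c:I} <= alpha_r <= alpha_{n-m+c}, and the local test rejects H_I
    ([local_test_rejects]).

    If H_i is not among them, the least favourable I removes
    H_(k), ..., H_(r) from the full set.  The j-th p-value in I is then
    P_(n-m+j) for j >= k, where n - m + j > r, so that no critical value is
    reached and H_I, hence H_i, is accepted ([local_test_accepts]). *)

Set Implicit Arguments.
Unset Strict Implicit.
Unset Printing Implicit Defensive.

Import Order.TTheory GRing.Theory Num.Theory.
Local Open Scope ring_scope.

Section Sublevel.
Variables (R : realFieldType) (n : nat).
Implicit Types (P : 'I_n -> R) (s : 'S_n) (I : {set 'I_n}) (x : R).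

Definition sublevel P x : {set 'I_n} := [set l | P l <= x].

Lemma mem_sublevel P x l : (l \in sublevel P x) = (P l <= x).
Proof. by rewrite inE. Qed.

(** The only link between order statistics and cardinalities; sorting does not
    occur in any later argument. *)
Lemma order_stat_le P I (j : nat) x : (1 <= j)%N -> (j <= #|I|)%N ->
  (order_stat P I j <= x) = (j <= #|I :&: sublevel P x|)%N.
Proof.
case: j => // j _ jI; rewrite /order_stat /=.
set t := sort _ _.
have t_sorted : sorted <=%O t by apply: sort_le_sorted.
have t_size : size t = #|I| by rewrite size_sort size_map -cardE.
have -> : #|I :&: sublevel P x| = count (<= x) t.
  rewrite /t count_sort count_map cardE.
  rewrite (_ : enum I = [seq l <- enum 'I_n | l \in I]); last by rewrite enumT.
  rewrite (_ : enum (I :&: _) =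
    [seq l <- enum 'I_n | l \in I :&: sublevel P x]); last by rewrite enumT.
  rewrite count_filter size_filter; apply: eq_count => l /=.
  by rewrite inE mem_sublevel andbC.
apply/idP/idP => [|jx]; last exact: nth_count_le.
apply: contraTT; rewrite -leqNgt => xj; rewrite -ltNge.
by apply: nth_count_gt => //; rewrite xj t_size.
Qed.

Lemma ordered_pval_le P (j : nat) x : (1 <= j)%N -> (j <= n)%N ->
  (ordered_pval P j <= x) = (j <= #|sublevel P x|)%N.
Proof.
by move=> j1 jn; rewrite /ordered_pval order_stat_le ?cardsT ?card_ord ?setTI.
Qed.

Lemma card_first_hyps s (r : nat) : (r <= n)%N -> #|first_hyps s r| = r.
Proof.
move=> rn; rewrite /first_hyps card_imset; last exact: perm_inj.
rewrite -[RHS]card_ord -!sum1_card (big_ord_widen _ (fun=> 1%N) rn).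
by apply: eq_bigl => a; rewrite inE.
Qed.

Lemma mem_first_hyps s (r : nat) (a : 'I_n) : (s a \in first_hyps s r) = (a < r)%N.
Proof. by rewrite mem_imset ?inE //; apply: perm_inj. Qed.

Lemma first_hyps_sub s (q r : nat) : (q <= r)%N -> first_hyps s q \subset first_hyps s r.
Proof.
move=> qr; apply/subsetP => _ /imsetP [a /[!inE] aq ->].
by rewrite mem_first_hyps (leq_trans aq).
Qed.

Lemma first_hyps_all s : first_hyps s n = [set: 'I_n].
Proof.
by apply/setP => l; rewrite inE -(permKV s l) mem_first_hyps ltn_ord.
Qed.

(** If P_(b) <= x, then P_(1), ..., P_(b) <= x as well, so b is at most the
    size of the sublevel set; equality follows by cardinality. *)
Lemma sublevel_initial P s x : pval_ordering P s ->
  sublevel P x = first_hyps s #|sublevel P x|.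
Proof.
move=> ordP; apply/eqP; rewrite eqEcard card_first_hyps ?leqnn ?andbT; last first.
  by rewrite -[leqRHS]card_ord max_card.
apply/subsetP => i; rewrite -(permKV s i); set b := (s^-1)%g i.
rewrite mem_sublevel mem_first_hyps => Pb.
rewrite -(@card_first_hyps s b.+1) ?ltn_ord //; apply/subset_leq_card/subsetP.
move=> _ /imsetP [a /[!inE] /[!ltnS] ab ->].
exact: le_trans (ordP _ _ ab) Pb.
Qed.

End Sublevel.

(** The degenerate case, in which only k - 1 hypotheses are rejected, is the
    value r = k - 1, and the total rejection is r = n; one argument then
    covers all the cases. *)
Lemma stepup_first_hyps (R : realFieldType) (n k : nat) (alpha : nat -> R)
    (P : 'I_n -> R) (s : 'S_n) : (1 <= k)%N -> (k <= n)%N ->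
  exists r : nat,
    [/\ stepup k alpha P s = first_hyps s r,
        (k.-1 <= r <= n)%N,
        (k <= r)%N -> ordered_pval P r <= alpha r &
        forall j : nat, (r < j)%N -> (j <= n)%N -> alpha j < ordered_pval P j].
Proof.
move=> k1 kn; rewrite /stepup; case: ifPn => [Pn|Pn].
  exists n; split=> //.
  - by rewrite first_hyps_all.
  - by rewrite leqnn (leq_trans (leq_pred k)).
  - by move=> j nj jn; rewrite ltnNge jn in nj.
case: ifPn => [/forallP above|/forallPn [r0]].
  exists k.-1; split=> //.
  - by rewrite leqnn (leq_trans (leq_pred k)).
  - by rewrite leqNgt prednK // leqnn.
  - rewrite prednK // => j kj jn.
    by have /implyP := above (Ordinal (jn : (j < n.+1)%N)); apply.
rewrite negb_imply -leNgt => /andP [kr0 Pr0].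
exists (stepup_index k alpha P); rewrite /stepup_index.
case: arg_minnP => [|r /andP [kr /forallP above] r_min].
  rewrite kn; apply/forallP => j; apply/implyP => nj.
  by rewrite ltnNge -ltnS ltn_ord in nj.
have above_r (j : nat) : (r < j)%N -> (j <= n)%N -> alpha j < ordered_pval P j.
  by move=> rj jn; have /implyP := above (Ordinal (jn : (j < n.+1)%N)); apply.
split=> //; first by rewrite (leq_trans (leq_pred k) kr) -ltnS ltn_ord.
move=> _; rewrite leNgt; apply/negP => Pr.
have r0r : (r0 < r)%N.
  rewrite ltnNge leq_eqVlt; apply/negP => /orP [/eqP rr0|rr0].
    by move: Pr0; rewrite -rr0 leNgt Pr.
  by have := above_r _ rr0 (ltn_ord r0); rewrite ltNge Pr0.
have r_gt0 : (0 < r)%N by apply: leq_ltn_trans r0r.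
have r1n : (r.-1 < n.+1)%N by rewrite (leq_ltn_trans (leq_pred r)).
(* As k <= r0 <= r - 1, the index r - 1 is admissible and contradicts the
   minimality of r. *)
suff: (r <= r.-1)%N by rewrite leqNgt prednK ?leqnn.
apply: (r_min (Ordinal r1n)); apply/andP; split=> /=.
  by rewrite -ltnS prednK // (leq_ltn_trans kr0).
apply/forallP => j; apply/implyP; rewrite prednK // leq_eqVlt.
case/orP => [/eqP <- //|rj]; exact: above_r rj (ltn_ord j).
Qed.

Section LocalTests.
Variables (R : realFieldType) (n k : nat) (alpha : nat -> R).
Variables (P : 'I_n -> R) (s : 'S_n) (r : nat).
Hypotheses (k_ge1 : (1 <= k)%N) (r_le_n : (r <= n)%N) (ordP : pval_ordering P s).

Let beta (i m : nat) := alpha (n - m + i)%N.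

(** The rank that witnesses rejection is the number c of indices of I with
    p-value at most alpha_r.  Counting by value rather than by rank gives both
    c >= k, from P_{k:I} <= P_i <= alpha_r, and P_{c:I} <= alpha_r; the
    monotonicity of alpha then absorbs the gap between r and n - m + c. *)
Lemma local_test_rejects (I : {set 'I_n}) (i : 'I_n) :
  (forall i j : nat, (k <= i)%N -> (i <= j)%N -> (j <= n)%N -> alpha i <= alpha j) ->
  (k <= r)%N -> ordered_pval P r <= alpha r -> i \in first_hyps s r ->
  (k <= #|I|)%N -> order_stat P I k <= P i -> local_test k beta P I.
Proof.
move=> alpha_mono kr Pr ir kI PkI.
have In : (#|I| <= n)%N by rewrite -[leqRHS]card_ord max_card.
set L := sublevel P (alpha r).
have rL : (r <= #|L|)%N by rewrite -ordered_pval_le // (leq_trans k_ge1).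
have iL : P i <= alpha r.
  suff: i \in L by rewrite mem_sublevel.
  by rewrite /L (sublevel_initial _ ordP); apply: subsetP ir; apply: first_hyps_sub.
pose c := #|I :&: L|.
have cI : (c <= #|I|)%N by rewrite subset_leq_card ?subsetIl.
have kc : (k <= c)%N by rewrite -order_stat_le // (le_trans PkI).
have rc : (r <= n - #|I| + c)%N.
  rewrite (leq_trans rL) // -(cardsID I L) setIC addnC leq_add2r.
  have -> : (n - #|I|)%N = #|~: I| by rewrite [RHS]cardsCs setCK card_ord.
  by rewrite subset_leq_card // setDE subsetIr.
apply/existsP; exists (Ordinal (leq_trans cI In : (c < n.+1)%N)) => /=.
rewrite kc cI order_stat_le ?(leq_trans k_ge1) //=.
apply/subset_leq_card/setIS/subsetP => l; rewrite !mem_sublevel => /le_trans; apply.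
apply: alpha_mono => //.
by rewrite -[leqRHS](subnK In) leq_add2l.
Qed.

(** The witness keeps H_(1), ..., H_(k-1), so that together with i it has
    k members with p-value at most P_i, and drops the other hypotheses among
    the first r, so that the critical value alpha_{n-m+j} compared with
    P_{j:I} is exactly the one which stepup compares with the same p-value. *)
Lemma local_test_accepts (i : 'I_n) :
  (k.-1 <= r)%N ->
  (forall j : nat, (r < j)%N -> (j <= n)%N -> alpha j < ordered_pval P j) ->
  i \notin first_hyps s r ->
  exists I : {set 'I_n},
    [/\ (k <= #|I|)%N, i \in I, order_stat P I k <= P i & ~~ local_test k beta P I].
Proof.
move=> kr above ir.
set K := first_hyps s k.-1; set M := first_hyps s r :\: K.
have KM (q : nat) : (r <= q)%N -> (q <= n)%N -> #|first_hyps s q :\: M| = (q - (r - k.-1))%N.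
  move=> rq qn; rewrite cardsD (setIidPr _); last first.
    by rewrite (subset_trans (subsetDl _ _)) ?first_hyps_sub.
  rewrite cardsD (setIidPr _) ?first_hyps_sub // !card_first_hyps //.
  exact: leq_trans r_le_n.
have iK : i \notin K by apply: contra ir; apply/subsetP/first_hyps_sub.
have iI : i \in ~: M by rewrite !inE (negPf ir) andbF.
have KI : K \subset ~: M by apply/subsetP => l lK; rewrite !inE lK.
have cardI : #|~: M| = (n - (r - k.-1))%N.
  by rewrite -KM // setDE first_hyps_all setTI.
have cardiK : #|i |: K| = k.
  by rewrite cardsU1 iK card_first_hyps ?(leq_trans kr) ?add1n ?prednK.
have iKI : i |: K \subset ~: M by rewrite subUset sub1set iI.
have kI : (k <= #|~: M|)%N by rewrite -[leqLHS]cardiK subset_leq_card.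
exists (~: M); split=> //.
  rewrite order_stat_le // -[leqLHS]cardiK subset_leq_card // subsetI iKI.
  apply/subsetP => l /setU1P [-> | ]; first by rewrite mem_sublevel.
  move=> /imsetP [a /[!inE] ak ->].
  move: ir; rewrite -{1}(permKV s i) mem_first_hyps -leqNgt => rb.
  rewrite -(permKV s i); apply: ordP.
  by rewrite ltnW // (leq_trans ak) // (leq_trans kr).
rewrite /local_test; apply/existsPn => -[j _] /=; rewrite /beta.
apply/negP => /and3P [kj jI]; rewrite order_stat_le ?(leq_trans k_ge1) //.
apply/negP; rewrite -ltnNge.
have dn : (r - k.-1 <= n)%N by rewrite (leq_trans (leq_subr _ _)).
set q := (n - #|~: M| + j)%N.
have qE : q = (r - k.-1 + j)%N by rewrite /q cardI subKn.
have rq : (r < q)%N.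
  by rewrite qE -[X in (X < _)%N](subnK kr) ltn_add2l -ltnS prednK // ltnS.
have qn : (q <= n)%N.
  by rewrite qE -[leqRHS](subnKC dn) leq_add2l -cardI.
(* As P_(q) > alpha_q, only indices among the first q - 1 have a p-value at
   most alpha_q, and r - k + 1 of these, all of M, have been removed. *)
have q_gt0 : (0 < q)%N by apply: leq_trans rq.
have Lq : (#|sublevel P (alpha q)| <= q.-1)%N.
  by rewrite -ltnS prednK // ltnNge -ordered_pval_le // -ltNge above.
have : (#|~: M :&: sublevel P (alpha q)| <= q.-1 - (r - k.-1))%N.
  rewrite -KM; last 2 first.
  - by rewrite -ltnS prednK.
  - by rewrite (leq_trans (leq_pred q)).
  rewrite setDE setIC subset_leq_card // setSI //.
  by rewrite (sublevel_initial _ ordP) first_hyps_sub.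
have j_gt0 : (0 < j)%N by rewrite (leq_trans k_ge1).
move/leq_ltn_trans; apply.
by rewrite qE -subn1 -addnBA // addKn subn1 prednK.
Qed.

End LocalTests.

Theorem theorem4p4 (R : realFieldType) (n k : nat) (alpha : nat -> R)
    (k_ge1 : (1 <= k)%N) (k_le_n : (k <= n)%N)
    (alpha_mono : forall i j : nat,
       (k <= i)%N -> (i <= j)%N -> (j <= n)%N -> alpha i <= alpha j) :
  equivalent (n := n) (stepup k alpha)
    (closed_testing k (fun i m : nat => alpha (n - m + i)%N)).
Proof.
move=> P s ordP.
have [r [-> /andP [kr rn] Pr above]] :=
  @stepup_first_hyps _ _ _ alpha P s k_ge1 k_le_n.
apply/setP => i; rewrite /closed_testing in_setU inE.
apply/idP/orP => [ir|[]].
- have [rk|k_le_r] := ltnP r k.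
    left; apply: subsetP ir; apply: first_hyps_sub.
    by rewrite -ltnS prednK.
  right; apply/forallP => I; apply/implyP => /and3P [kI _ PkI].
  exact: (local_test_rejects k_ge1 rn ordP alpha_mono k_le_r (Pr k_le_r) ir).
- by apply/subsetP/first_hyps_sub.
- move=> /forallP rej; apply: contraT => ir.
  have [I [kI iI PkI /negP]] :=
    local_test_accepts k_ge1 rn ordP kr above ir.
  by case; have /implyP := rej I; apply; rewrite kI iI.
Qed.
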